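(* For every fixed real $\rho>1/2$, the following Poincaré asymptotic expansion holds as $y\to+\infty$: $$\int_y^\infty e^{-x}\,\frac{I_{\rho-1}(x)}{x^\rho}\,dx\sim \frac{y^{-\rho+1/2}}{\sqrt{2\pi}}\sum_{k=0}^\infty \frac{(-1)^k\, \Gamma(\rho+k-\frac12)}{(\rho+k-\frac12)\, \Gamma(\rho-k-\frac12)\,k!}\,(2y)^{-k}.$$
   Context: $I_\nu$ denotes the modified Bessel function of the first kind of order $\nu$, $I_\nu(t) := \sum_{k=0}^{\infty} \frac{(t/2)^{2k+\nu}}{k!\,\Gamma(k+1+\nu)}$. A Poincaré asymptotic expansion $F(y)\sim h(y)\sum_{k=0}^\infty c_k y^{-k}$ as $y\to+\infty$ means that for every integer $N\ge 0$, $F(y)=h(y)\left(\sum_{k=0}^{N-1} c_k y^{-k}+O(y^{-N})\right)$ as $y\to+\infty$. The factor $1/\Gamma(z)$ is interpreted as $0$ when $z\in\{0,-1,-2,\ldots\}$. *)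

(* Defs.v *)
From mathcomp Require Import all_boot all_order all_algebra.
From mathcomp Require Import all_classical all_reals all_analysis.
Import Order.TTheory GRing.Theory Num.Theory.
Import numFieldNormedType.Exports.

Set Implicit Arguments.
Unset Strict Implicit.
Unset Printing Implicit Defensive.

Local Open Scope classical_set_scope.
Local Open Scope ring_scope.

Definition Euler_integral (R : realType) (z : R) : R :=
  (\int[@lebesgue_measure R]_(t in `]0, +oo[) (t `^ (z - 1) * expR (- t)))%R.

(* For z <= 0, Gamma z = Gamma (z + n) / (z (z + 1) ... (z + n - 1)), where n is
   the least natural number such that 0 < z + n. At the poles 0, -1, -2, ... the
   denominator vanishes, so that Gamma z = 0 and (Gamma z)^-1 = 0 there, the
   latter being the value of the entire function 1 / Gamma (see Gamma_pole). *)
Definition Gamma (R : realType) (z : R) : R :=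
  let n := if 0 < z then 0%N else (Num.truncn (- z)).+1 in
  Euler_integral (z + n%:R) / \prod_(i < n) (z + i%:R).

Lemma Gamma_pole (R : realType) (m : nat) : (Gamma (- m%:R : R))^-1 = 0.
Proof.
rewrite /Gamma oppr_gt0 ltrn0 opprK natrK (bigD1 (ord_max : 'I_m.+1)) //=.
by rewrite addNr mul0r invr0 mulr0 invr0.
Qed.

(* Modified Bessel function of the first kind, meant for t > 0: the real power
   is expR (a * ln x) for x > 0. *)
Definition besselI (R : realType) (nu t : R) : R :=
  limn (series (fun k : nat =>
    (t / 2) `^ ((2 * k)%:R + nu) / (k`!%:R * Gamma (k%:R + 1 + nu)))).

Canonical pinfty_filter_on (R : numFieldType) : filter_on R :=
  FilterType (pinfty_nbhs R) (@proper_pinfty_nbhs R : Filter _).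

Definition Poincare_expansion (R : realType) (F h : R -> R) (c : nat -> R) :
    Prop :=
  forall N : nat, exists2 r : R -> R,
    (r : R -> R^o) =O_ (pinfty_nbhs R) (fun y : R => y ^- N : R^o) &
    \forall y \near +oo, F y = h y * (\sum_(k < N) c k * y ^- k + r y).

(* Main.v *)
Require Import Defs.
From mathcomp Require Import all_boot all_order all_algebra.
From mathcomp Require Import all_classical all_reals all_analysis.
From mathcomp Require Import measurable_realfun ring lra.
Set Implicit Arguments.
Unset Strict Implicit.
Unset Printing Implicit Defensive.
Import Order.TTheory GRing.Theory Num.Theory.
Import numFieldNormedType.Exports.
Local Open Scope classical_set_scope.
Local Open Scope ring_scope.

(** Write a = rho - 1/2. Expanding the even part of the exponential in Poisson's
integral of (1 - t^2)^(a-1) e^(-xt) over (-1, 1) and integrating termwise gives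
  I_(a-1/2)(x) = (x/2)^(a-1/2) / (sqrt(pi) Gamma(a))
                 * \int_(-1)^1 (1 - t^2)^(a-1) e^(-xt) dt,
where the even moments of the weight are Beta values. These come from Tonelli's
theorem applied to (s - v^2)_+^(a-1) v^(2j) e^(-s); the case a = 1 of the same
identity evaluates the Gaussian moments. With s = 1 + t, e^(-x) I_(a-1/2)(x) is a
Laplace integral of s^(a-1) (2 - s)^(a-1), and Watson's lemma (Taylor expansion
of (2 - s)^(a-1) at s = 0) yields the expansion of the integrand with an explicit
remainder C x^(-a-N-1) valid for every x > 0, which is then integrated over
(y, +oo). *)

(** The hypothesis rho > 1/2 says a > 0, which is what makes the weight integrable at t = -1 and t =
    1. For a < 1 it blows up at both ends. The singularity at s = 0 is harmless, being shared by
    every term of the expansion; the one at s = 2 rules out a global Taylor bound C s^N. The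
    remainder therefore keeps the factor (2 - s)_+^(a-1) for s > 1, and exponential decay absorbs
    it. A bound for all x > 0 makes the last integration a plain inequality on every (y, +oo); its
    case N = 0 also gives the integrability of the integrand. Integrals of nonnegative functions are
    evaluated in [0, +oo] and finiteness is read off afterwards: Tonelli takes the place of
    integration by parts in the recurrence of Gamma, and monotone convergence that of domination in
    the series for Poisson's integral. The coefficients 1 / Gamma (a - k) arise from binomial
    coefficients through the recurrence of 1 / Gamma, which stays valid at the poles; for integer a
    they vanish from k = a on. *)

(** * Changes of variables for nonnegative integrals *)

(** By uniqueness of Lebesgue measure: c times its image under x -> c x + d gives every half-open
    interval its length. *)
Lemma ge0_integral_affine (R : realType) (f : R -> \bar R) (c d : R) : 0 < c ->
  measurable_fun [set: R] f -> (forall x, (0 <= f x)%E) ->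
  (\int[@lebesgue_measure R]_x f (c * x + d)%R =
   c^-1%:E * \int[@lebesgue_measure R]_x f x)%E.
Proof.
move=> c0 mf f0.
pose phi : measurableTypeR R -> measurableTypeR R := fun x => c * x + d.
have mphi : measurable_fun setT phi.
  by apply: measurable_funD => //; exact: measurable_funM.
have cE : c = (NngNum (ltW c0))%:num by [].
have -> : (\int[lebesgue_measure]_x f x =
    c%:E * \int[pushforward lebesgue_measure phi]_x f x)%E.
  rewrite [in RHS]cE -ge0_integral_mscale//.
  apply: eq_measure_integral => A mA _.
  have := @lebesgue_measure_unique R
    (mscale (NngNum (ltW c0)) (pushforward lebesgue_measure phi)).
  apply => // X [[a b] _ <-].
  pose J : set R := `](a - d) / c, (b - d) / c]%classic.
  rewrite [RHS](_ : _ = c%:E * lebesgue_measure J)%E; last first.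
    suff <- : phi @^-1` `]a, b]%classic = J by [].
    apply/seteqP; split => x; rewrite /J/= !in_itv/= ltr_pdivrMr// ler_pdivlMr//;
    by rewrite /phi ltrBlDr lerBrDr (mulrC x).
  rewrite !lebesgue_measure_itv/= !lte_fin ltr_pM2r ?invr_gt0// ltrD2r.
  case: ifP => _; last by rewrite mule0.
  by rewrite -!EFinD -EFinM; congr EFin; field; rewrite gt_eqF.
rewrite muleA -EFinM mulVf ?gt_eqF// mul1e ge0_integral_pushforward//.
Qed.

Lemma ge0_integral_opp (R : realType) (f : R -> \bar R) :
  measurable_fun [set: R] f -> (forall x, (0 <= f x)%E) ->
  (\int[@lebesgue_measure R]_x f (- x)%R = \int[@lebesgue_measure R]_x f x)%E.
Proof.
move=> mf f0.
transitivity (\int[pushforward lebesgue_measure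
    (-%R : _ -> measurableTypeR R)]_x f x)%E.
  by rewrite ge0_integral_pushforward.
by apply: eq_measure_integral => //= A mA _; exact: lebesgue_measureN.
Qed.

(** * Tails of powers, and powers cut off at 0 *)

Lemma cvgNy_powR (R : realType) (p : R) : 0 < p -> x `^ (- p) @[x --> +oo] --> (0 : R).
Proof.
move=> p0.
have : expR (- (p * ln x)) @[x --> +oo] --> (0 : R).
  apply: (@cvg_comp _ _ _ (fun x => p * ln x) (fun y => expR (- y)) _ +oo);
    last exact: cvgr_expR.
  apply/cvgryPge => A; near=> x.
  by rewrite mulrC -ler_pdivrMr// -ler_expR lnK// posrE.
by apply: cvg_trans; apply: near_eq_cvg; near=> x; rewrite /powR gt_eqF// mulNr.
Unshelve. all: by end_near. Qed.

Lemma integral_powR_tail (R : realType) (p y : R) : 0 < p -> 0 < y ->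
  (\int[@lebesgue_measure R]_(x in `]y, +oo[) (x `^ (- p - 1))%:E =
   (y `^ (- p) / p)%:E)%E.
Proof.
move=> p0 y0.
have dF (x : R) : 0 < x -> is_derive x 1 (fun x => - (p^-1 * x `^ (- p))) (x `^ (- p - 1)).
  move=> x0.
  have dp := is_derive1_powR (- p) x0.
  apply: is_derive_eq; rewrite /GRing.scale/=; field; by rewrite gt_eqF.
rewrite integral_itv_obnd_cbnd; last first.
  by apply/measurable_EFinP; apply: measurable_funTS; exact: measurable_powR.
rewrite (@ge0_continuous_FTC2y _ _ (fun x => - (p^-1 * x `^ (- p))) _ 0).
- by rewrite sub0e -EFinN opprK mulrC.
- by move=> x _; exact: powR_ge0.
- apply: derivable_within_continuous => x; rewrite in_itv/= andbT => yx.
  by apply: derivable_powR; rewrite in_itv/= (lt_le_trans y0).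
- rewrite -oppr0 -(mulr0 p^-1); apply: cvgN; apply: cvgMr; exact: cvgNy_powR.
- by move=> x yx; apply: ex_derive; apply: dF; exact: lt_trans yx.
- apply: cvg_at_right_filter.
  by have [/derivable1_diffP/differentiable_continuous] := dF y y0.
- move=> x; rewrite in_itv/= andbT => yx; rewrite derive1E.
  by apply: derive_val; apply: dF; exact: lt_trans yx.
Qed.

(* The library's x `^ p is 1 for x < 0, so the positive part has to be cut off by hand. *)
Definition ppowR (R : realType) (p x : R) : R := if 0 < x then x `^ p else 0.

Lemma ppowRE (R : realType) (p x : R) : 0 < x -> ppowR p x = x `^ p.
Proof. by rewrite /ppowR => ->. Qed.

Lemma ppowR_le0 (R : realType) (p x : R) : x <= 0 -> ppowR p x = 0.
Proof. by rewrite /ppowR ltNge => ->. Qed.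

Lemma ppowR_ge0 (R : realType) (p x : R) : 0 <= ppowR p x.
Proof. by rewrite /ppowR; case: ifP => // _; exact: powR_ge0. Qed.

Lemma measurable_ppowR (R : realType) (p : R) : measurable_fun [set: R] (ppowR p).
Proof.
by apply: measurable_fun_ifT => //; exact: measurable_fun_ltr.
Qed.

Lemma ppowRM (R : realType) (p x y : R) : 0 < x ->
  ppowR p (x * y) = x `^ p * ppowR p y.
Proof.
move=> x0; rewrite /ppowR pmulr_rgt0//; case: ifPn => y0; last by rewrite mulr0.
by rewrite powRM// ltW.
Qed.

Lemma ppowRD (R : realType) (p q x : R) : ppowR p x * ppowR q x = ppowR (p + q) x.
Proof.
rewrite /ppowR; case: ifPn => x0; last by rewrite mulr0.
by rewrite powRD// (gt_eqF x0) implybT.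
Qed.

Lemma ppowRX (R : realType) (p x : R) (n : nat) :
  ppowR p x * x ^+ n = ppowR (p + n%:R) x.
Proof.
rewrite -ppowRD /ppowR; case: ifPn => x0; last by rewrite !mul0r.
by rewrite powR_mulrn// ltW.
Qed.

Lemma ppowR_integral (R : realType) (p : R) (f : R -> R) :
  (\int[@lebesgue_measure R]_x (ppowR p x * f x)%:E =
   \int[@lebesgue_measure R]_(x in `]0%R, +oo[) (x `^ p * f x)%:E)%E.
Proof.
rewrite [RHS]integral_mkcond; apply: eq_integral => x _.
rewrite /patch; case: ifPn => /=; rewrite mem_setE in_itv/= andbT.
  by move=> x0; rewrite ppowRE.
by rewrite -leNgt => x0; rewrite ppowR_le0// mul0r.
Qed.

(** * Euler's integral and the Gamma function *)

(** Extended-real valued, so that Tonelli and the recurrence apply before finiteness is known. *)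
Definition egamma (R : realType) (z : R) : \bar R :=
  (\int[@lebesgue_measure R]_x (ppowR (z - 1) x * expR (- x))%:E)%E.

Lemma Euler_integralE (R : realType) (z : R) : Euler_integral z = fine (egamma z).
Proof. by rewrite /egamma ppowR_integral. Qed.

Lemma measurable_ppowR_expR (R : realType) (p c : R) :
  measurable_fun [set: R] (fun x => ppowR p x * expR (- (c * x))).
Proof.
apply: measurable_funM; first exact: measurable_ppowR.
by apply: measurableT_comp => //; apply: measurableT_comp => //.
Qed.

Lemma egamma_scale (R : realType) (z c : R) : 0 < c ->
  (\int[@lebesgue_measure R]_x (ppowR (z - 1) x * expR (- (c * x)))%:E =
   (c `^ (- z))%:E * egamma z)%E.
Proof.
move=> c0.
have mf : measurable_fun [set: R] (fun x : R => (ppowR (z - 1) x * expR (- x))%:E).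
  apply/measurable_EFinP; have := @measurable_ppowR_expR R (z - 1) 1.
  by under eq_fun do rewrite mul1r.
have := @ge0_integral_affine R _ c 0 c0 mf.
rewrite -/(egamma z) => H.
transitivity ((c `^ (1 - z))%:E * ((c^-1)%:E * egamma z))%E; last first.
  rewrite muleA -EFinM -{2}(powRr1 (ltW c0)) -powRN -powRD; last first.
    by rewrite (gt_eqF c0) implybT.
  by congr ((c `^ _)%:E * _)%E; ring.
rewrite -H; last by move=> x; rewrite lee_fin mulr_ge0// ?expR_ge0// ppowR_ge0.
rewrite -ge0_integralZl_EFin//=; last 3 first.
- by move=> x _; rewrite lee_fin mulr_ge0// ?expR_ge0// ppowR_ge0.
- have /measurable_EFinP := @measurable_ppowR_expR R (z - 1) c.
  move=> mg; under eq_fun => x do rewrite addr0 ppowRM// -mulrA EFinM.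
  exact: measurable_funeM.
- exact: powR_ge0.
apply: eq_integral => x _; rewrite addr0 ppowRM// -EFinM; congr EFin.
rewrite !mulrA -powRD; last by rewrite (gt_eqF c0) implybT.
by rewrite (_ : 1 - z + (z - 1) = 0) ?powRr0 ?mul1r//; ring.
Qed.

Lemma egamma1 (R : realType) : egamma (1 : R) = 1%E.
Proof.
rewrite /egamma subrr ppowR_integral.
under eq_integral do rewrite powRr0 mul1r.
have dF (x : R) : is_derive x 1 (fun x : R => - expR (- x)) (expR (- x)).
  apply: is_derive_eq; rewrite /GRing.scale/=; ring.
rewrite integral_itv_obnd_cbnd; last first.
  by apply/measurable_EFinP; apply: measurable_funTS; apply: measurableT_comp.
rewrite (@ge0_continuous_FTC2y _ _ (fun x : R => - expR (- x)) _ 0).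
- by rewrite sub0e -EFinN opprK oppr0 expR0.
- by move=> x _; exact: expR_ge0.
- apply: continuous_subspaceT => x.
  apply: (@continuous_comp _ _ _ -%R expR); first exact: continuousN.
  exact: continuous_expR.
- by rewrite -oppr0; apply: cvgN; exact: cvgr_expR.
- by move=> x _; apply: ex_derive.
- apply: cvg_at_right_filter.
  by have [/derivable1_diffP/differentiable_continuous] := dF 0.
- by move=> x _; rewrite derive1E; apply: derive_val.
Qed.

Lemma integral_expR_tail (R : realType) (s : R) : 0 < s ->
  (\int[@lebesgue_measure R]_x (ppowR 0 (x - 1) * expR (- (s * x)))%:E =
   (expR (- s) / s)%:E)%E.
Proof.
move=> s0.
have mf : measurable_fun [set: R] (fun x : R => (ppowR 0 x * expR (- (s * x)))%:E).
  by apply/measurable_EFinP; exact: measurable_ppowR_expR.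
have f0 (x : R) : (0 <= (ppowR 0 x * expR (- (s * x)))%:E)%E.
  by rewrite lee_fin mulr_ge0// ?expR_ge0// ppowR_ge0.
transitivity ((expR (- s))%:E *
    \int[@lebesgue_measure R]_x (ppowR 0 x * expR (- (s * x)))%:E)%E.
  have := @ge0_integral_affine R _ 1 (- 1) ltr01 mf f0.
  rewrite invr1 mul1e => <-.
  rewrite -ge0_integralZl_EFin//.
  - apply: eq_integral => x _; rewrite -EFinM mul1r mulrCA -expRD.
    by congr (_ * expR _)%:E; ring.
  - move: mf => /measurable_EFinP mf; apply/measurable_EFinP.
    by apply: (measurableT_comp mf); apply: measurable_funD.
have := @egamma_scale R 1 s s0; rewrite subrr => ->.
by rewrite egamma1 mule1 -EFinM powRN powRr1// ltW.
Qed.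

(* Both sides arise from integrating s^z e^(-xs) over x > 1 and s > 0. *)
Lemma egammaS (R : realType) (z : R) : 0 < z ->
  (egamma (z + 1) = z%:E * egamma z)%E.
Proof.
(* The factor [ppowR 0 (u.1 - 1)] is the indicator of u.1 > 1. *)
move=> z0; pose g (u : R * R) := (ppowR 0 (u.1 - 1) * (ppowR z u.2 * expR (- (u.1 * u.2))))%:E.
have mg : measurable_fun setT g.
  apply/measurable_EFinP; apply: measurable_funM.
    apply: measurableT_comp; first exact: measurable_ppowR.
    exact: measurable_funD.
  apply: measurable_funM.
    by apply: measurableT_comp => //; exact: measurable_ppowR.
  apply: measurableT_comp => //; apply: measurableT_comp => //.
  exact: measurable_funM.
have g0 u : (0 <= g u)%E.
  by rewrite lee_fin mulr_ge0 ?ppowR_ge0// mulr_ge0 ?ppowR_ge0// expR_ge0.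
(* With s innermost the result is Gamma (z + 1) x^(-z-1), whose tail from 1 contributes 1 / z. *)
have e1 : (\int[@lebesgue_measure R]_x \int[@lebesgue_measure R]_y g (x, y) =
    egamma (z + 1) * z^-1%:E)%E.
  transitivity (\int[@lebesgue_measure R]_(x in `]1%R, +oo[)
      (egamma (z + 1) * (x `^ (- z - 1))%:E))%E.
    rewrite [RHS]integral_mkcond; apply: eq_integral => x _.
    rewrite /patch; case: ifPn => /=; rewrite mem_setE in_itv/= andbT.
      move=> x1; rewrite /g/=.
      under eq_integral do rewrite ppowRE ?subr_gt0// powRr0 mul1r.
      have := @egamma_scale R (z + 1) x (lt_trans ltr01 x1); rewrite addrK => ->.
      by rewrite muleC opprD.
    rewrite -leNgt => x1; rewrite /g/=; apply: integral0_eq => y _.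
    by rewrite ppowR_le0 ?subr_le0// mul0r.
  rewrite ge0_integralZl//; last 3 first.
  - apply/measurable_EFinP; apply: measurable_funTS; exact: measurable_powR.
  - by move=> x _; rewrite lee_fin powR_ge0.
  - by apply: integral_ge0 => x _; rewrite lee_fin mulr_ge0 ?ppowR_ge0 ?expR_ge0.
  by rewrite integral_powR_tail// powR1 mul1r.
(* With x innermost the result is e^(-s) / s, which lowers s^z to s^(z-1). *)
have e2 : (\int[@lebesgue_measure R]_y \int[@lebesgue_measure R]_x g (x, y) =
    egamma z)%E.
  apply: eq_integral => s _; rewrite /g/=.
  have [s0|s0] := leP s 0.
    rewrite (ppowR_le0 (z - 1))// mul0r; apply: integral0_eq => y _.
    by rewrite (ppowR_le0 z)// mul0r mulr0.
  under eq_integral do rewrite mulrCA (mulrC _ s) EFinM.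
  rewrite ge0_integralZl_EFin//; last 3 first.
  - by move=> x _; rewrite lee_fin mulr_ge0 ?ppowR_ge0 ?expR_ge0.
  - apply/measurable_EFinP; apply: measurable_funM.
      apply: measurableT_comp; first exact: measurable_ppowR.
      exact: measurable_funD.
    apply: measurableT_comp => //; apply: measurableT_comp => //.
  - exact: ppowR_ge0.
  rewrite integral_expR_tail// -EFinM !ppowRE//.
  rewrite powRB; last by rewrite (gt_eqF s0) implybT.
  by rewrite powRr1 ?ltW//; congr EFin; ring.
have := @fubini_tonelli _ _ _ _ R lebesgue_measure lebesgue_measure g mg g0.
rewrite e1 e2 => <-.
by rewrite muleCA -EFinM divff ?mule1// gt_eqF.
Qed.

(** Apply ln v <= v - 1 to v = u / (p + 1). Dividing by p + 1 instead of the maximiser p covers p =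
    0 by the same argument. *)
Lemma powR_expR_bounded (R : realType) (p : R) : 0 <= p ->
  exists2 C : R, 0 < C & forall u : R, 0 < u -> u `^ p * expR (- u) <= C.
Proof.
move=> p0; have q0 : 0 < p + 1 by lra.
exists ((p + 1) `^ p); first exact: powR_gt0.
move=> u u0; rewrite /powR !gt_eqF// -expRD ler_expR.
have : ln (u / (p + 1)) <= u / (p + 1) - 1.
  rewrite -[X in ln X](subrK 1) addrC; apply: le_ln1Dx.
  by rewrite ltrBrDr addrC subrr divr_gt0.
rewrite ln_div ?posrE// => H.
have : u / (p + 1) * (p + 1) = u by rewrite divfK// gt_eqF.
have : 0 < u / (p + 1) by rewrite divr_gt0.
set v := u / (p + 1) in H *; nra.
Qed.

Lemma egamma_ge0 (R : realType) (z : R) : (0 <= egamma z)%E.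
Proof.
by apply: integral_ge0 => x _; rewrite lee_fin mulr_ge0 ?expR_ge0 ?ppowR_ge0.
Qed.

(** For exponents at least 1, half of the exponential absorbs the power and the other half is
    integrable. The recurrence then carries finiteness from z + 1 back to z, which settles the
    singularity at 0 when z < 1. *)
Lemma egamma_lty (R : realType) (z : R) : 0 < z -> (egamma z < +oo)%E.
Proof.
move=> z0.
suff H (y : R) : 1 <= y -> (egamma y < +oo)%E.
  have : (z%:E * egamma z < +oo)%E.
    by rewrite -egammaS//; apply: H; rewrite lerDr ltW.
  have := egamma_ge0 z; case: (egamma z) => [r| |] //= _; rewrite ?ltry//.
  by rewrite gt0_muley// lte_fin.
move=> y1; have y10 : 0 <= y - 1 by rewrite subr_ge0.
have [C C0 HC] := powR_expR_bounded y10.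
have mg : measurable_fun [set: R] (fun x : R => (ppowR 0 x * expR (- (2^-1 * x)))%:E).
  by apply/measurable_EFinP; exact: measurable_ppowR_expR.
have g0 (x : R) : (0 <= (ppowR 0 x * expR (- (2^-1 * x)))%:E)%E.
  by rewrite lee_fin mulr_ge0// ?expR_ge0// ppowR_ge0.
have CP : 0 <= C * 2 `^ (y - 1) by rewrite mulr_ge0 ?powR_ge0// ltW.
apply: (@le_lt_trans _ _ ((C * 2 `^ (y - 1))%:E *
    \int[lebesgue_measure]_x (ppowR 0 x * expR (- (2^-1 * x)))%:E)%E).
  rewrite -ge0_integralZl_EFin//.
  apply: ge0_le_integral => //.
  - by move=> x _; rewrite lee_fin mulr_ge0// ?expR_ge0// ppowR_ge0.
  - apply/measurable_EFinP; have := @measurable_ppowR_expR R (y - 1) 1.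
    by under eq_fun do rewrite mul1r.
  - exact: measurable_funeM.
  move=> x _; rewrite -EFinM lee_fin.
  have [x0|x0] := leP x 0; first by rewrite !ppowR_le0// !mul0r mulr0.
  rewrite !ppowRE// powRr0 mul1r.
  pose w : R := 2^-1 * x; have w0 : 0 < w by rewrite mulr_gt0.
  have xE : x = 2 * w by rewrite /w; field.
  rewrite -/w [X in X `^ _]xE [X in expR (- X)]xE
    (powRM _ (ler0n _ 2) (ltW w0)).
  have -> : expR (- (2 * w)) = expR (- w) * expR (- w).
    by rewrite -expRD; congr expR; ring.
  have : 2 `^ (y - 1) * expR (- w) * (w `^ (y - 1) * expR (- w)) <=
         2 `^ (y - 1) * expR (- w) * C.
    by apply: ler_wpM2l; [rewrite mulr_ge0 ?powR_ge0 ?expR_ge0|exact: HC].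
  by congr (_ <= _); ring.
have := @egamma_scale R 1 2^-1; rewrite subrr invr_gt0 => ->//.
by rewrite egamma1 mule1 -EFinM ltry.
Qed.

Lemma egamma_gt0 (R : realType) (z : R) : (0 < egamma z)%E.
Proof.
(* On [1, 2] one has 0 <= ln x <= 1, so x^(z-1) >= e^(-|z-1|) and e^(-x) >= e^(-2). *)
pose c : R := expR (- (`|z - 1| + 2)).
have c0 : 0 < c by exact: expR_gt0.
apply: (@lt_le_trans _ _ (\int[@lebesgue_measure R]_(x in `[1%R, 2%R]) c%:E)%E).
  rewrite integral_cst//= lebesgue_measure_itv/= lte_fin ltr1n -EFinB -EFinM.
  by rewrite lte_fin mulr_gt0// subr_gt0 ltr1n.
rewrite integral_mkcond /egamma; apply: ge0_le_integral => //=.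
- by move=> x _; apply: erestrict_ge0 => y _; rewrite lee_fin ltW.
- by apply/(measurable_restrictT _ _).1 => //; exact: measurable_cst.
- apply/measurable_EFinP; have := @measurable_ppowR_expR R (z - 1) 1.
  by under eq_fun do rewrite mul1r.
move=> x _; rewrite /patch; case: ifPn; last first.
  by move=> _; rewrite lee_fin mulr_ge0 ?expR_ge0 ?ppowR_ge0.
rewrite mem_setE in_itv/= => /andP[x1 x2]; rewrite lee_fin.
have x0 : 0 < x by exact: lt_le_trans x1.
rewrite ppowRE// /powR gt_eqF// -expRD ler_expR.
have lx0 : 0 <= ln x by exact: ln_ge0.
have lx1 : ln x <= 1.
  rewrite -ler_expR lnK ?posrE// (le_trans x2)//.
  by have := expR_ge1Dx (1 : R); rewrite -(natrD _ 1 1).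
have : - (`|z - 1|) <= (z - 1) * ln x.
  rewrite lerNl -mulNr (le_trans (ler_norm _))// normrM normrN.
  by rewrite ler_piMr// ger0_norm.
lra.
Qed.

Lemma Gamma_gt0E (R : realType) (z : R) : 0 < z -> Gamma z = fine (egamma z).
Proof.
by move=> z0; rewrite /Gamma z0 addr0 big_ord0 divr1 Euler_integralE.
Qed.

Lemma EFin_Gamma (R : realType) (z : R) : 0 < z -> (Gamma z)%:E = egamma z.
Proof.
move=> z0; rewrite Gamma_gt0E// fineK// ge0_fin_numE ?egamma_ge0//.
exact: egamma_lty.
Qed.

Lemma Gamma_gt0 (R : realType) (z : R) : 0 < z -> 0 < Gamma z.
Proof. by move=> z0; rewrite -lte_fin EFin_Gamma// egamma_gt0. Qed.

Lemma GammaS_gt0 (R : realType) (z : R) : 0 < z -> Gamma (z + 1) = z * Gamma z.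
Proof.
move=> z0; have z10 : 0 < z + 1 by lra.
by have := egammaS z0; rewrite -!EFin_Gamma// -EFinM => -[].
Qed.

(** Stated for 1 / Gamma so as to hold at every real z: at the poles both sides are 0. For z <= 0
    the product defining Gamma at z is the one at z + 1 with the extra factor z. *)
Lemma GammaV (R : realType) (z : R) : (Gamma z)^-1 = z / Gamma (z + 1).
Proof.
have [z0|z0] := ltP 0 z.
  have := Gamma_gt0 z0; rewrite GammaS_gt0// => g0.
  by field; rewrite !gt_eqF.
have Nz0 : 0 <= - z by rewrite oppr_ge0.
suff -> : Gamma z = Gamma (z + 1) / z by rewrite invf_div.
have [z1|z1] := ltP 0 (z + 1).
  have t0 : Num.truncn (- z) = 0%N.
    by apply: truncn_def; apply/andP; split; lra.
  rewrite /Gamma ltNge z0/= z1 t0 addr0 big_ord0 divr1 big_ord1 addr0.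
  by [].
have t1 : Num.truncn (- z) = (Num.truncn (- (z + 1))).+1.
  apply: truncn_def; have /truncn_itv : 0 <= - (z + 1) by rewrite oppr_ge0.
  set m := Num.truncn _; rewrite -[m.+2%:R]natr1 -[m.+1%:R]natr1.
  by move=> /andP[A B]; apply/andP; split; lra.
rewrite /Gamma !ltNge z0 z1/= t1.
set n := Num.truncn _.
rewrite [in LHS]big_ord_recl/= addr0.
have -> : \prod_(i < n.+1) (z + (bump 0 i)%:R) = \prod_(i < n.+1) (z + 1 + i%:R).
  by apply: eq_bigr => i _; rewrite /bump/= natrD addrA.
rewrite (_ : z + n.+2%:R = z + 1 + n.+1%:R); last by rewrite -[n.+2%:R]nat1r addrA.
by rewrite invfM mulrA mulrAC.
Qed.

(** * Beta and Gaussian moments *)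

(** Left side: v is integrated first, the scaling by sqrt s splits off the Beta integral and leaves
    s^(a+j-1/2) e^(-s). Right side: s is integrated first, the shift by v^2 splits off Gamma a and
    leaves e^(-v^2). *)
Lemma Gamma_beta_gauss (R : realType) (a : R) (j : nat) : 0 < a ->
  (egamma (a + j%:R + 2^-1) *
     \int[@lebesgue_measure R]_t (ppowR (a - 1) (1 - t ^+ 2) * (t ^+ 2) ^+ j)%:E =
   egamma a * \int[@lebesgue_measure R]_v ((v ^+ 2) ^+ j * expR (- v ^+ 2))%:E)%E.
Proof.
move=> a0.
have X0 (v : R) : 0 <= (v ^+ 2) ^+ j by apply: exprn_ge0; exact: sqr_ge0.
pose h (u : R * R) :=
  (ppowR (a - 1) (u.1 - u.2 ^+ 2) * ((u.2 ^+ 2) ^+ j * expR (- u.1)))%:E.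
have mh : measurable_fun setT h.
  apply/measurable_EFinP; apply: measurable_funM.
    apply: measurableT_comp; first exact: measurable_ppowR.
    apply: measurable_funB => //.
    by apply: measurable_funX.
  apply: measurable_funM.
    by apply: measurable_funX; apply: measurable_funX.
  by apply: measurableT_comp => //; apply: measurableT_comp.
have h0 u : (0 <= h u)%E.
  by rewrite lee_fin mulr_ge0 ?ppowR_ge0// mulr_ge0 ?expR_ge0// X0.
have mB : measurable_fun [set: R]
    (fun t : R => (ppowR (a - 1) (1 - t ^+ 2) * (t ^+ 2) ^+ j)%:E).
  apply/measurable_EFinP; apply: measurable_funM.
    apply: measurableT_comp; first exact: measurable_ppowR.
    by apply: measurable_funB => //; apply: measurable_funX.
  by apply: measurable_funX; apply: measurable_funX.
have B0 (t : R) : (0 <= (ppowR (a - 1) (1 - t ^+ 2) * (t ^+ 2) ^+ j)%:E)%E.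
  by rewrite lee_fin mulr_ge0 ?ppowR_ge0 ?X0.
have mv (s : R) : measurable_fun [set: R] (fun v : R => h (s, v)).
  exact: (measurableT_comp mh (measurable_pair1 s)).
set B := (\int[@lebesgue_measure R]_t (ppowR (a - 1) (1 - t ^+ 2) * (t ^+ 2) ^+ j)%:E)%E.
(* Substitute v = sqrt s * t in the inner integral. *)
have e1 : (\int[@lebesgue_measure R]_s \int[@lebesgue_measure R]_v h (s, v) =
    B * egamma (a + j%:R + 2^-1))%E.
  rewrite -ge0_integralZl//; last 3 first.
  - apply/measurable_EFinP.
    have := @measurable_ppowR_expR R (a + j%:R + 2^-1 - 1) 1.
    by under eq_fun do rewrite mul1r.
  - by move=> x _; rewrite lee_fin mulr_ge0 ?ppowR_ge0 ?expR_ge0.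
  - by apply: integral_ge0 => t _; exact: B0.
  apply: eq_integral => s _; have [s0|s0] := leP s 0.
    rewrite (ppowR_le0 _ s0) mul0r mule0; apply: integral0_eq => v _.
    by rewrite /h/= ppowR_le0 ?mul0r// subr_le0 (le_trans s0)// sqr_ge0.
  have r0 : 0 < Num.sqrt s by rewrite sqrtr_gt0.
  have := @ge0_integral_affine R _ (Num.sqrt s) 0 r0 (mv s) (fun v => h0 (s, v)).
  move=> /(congr1 (mule (Num.sqrt s)%:E)).
  rewrite muleA -EFinM divff ?gt_eqF// mul1e => <-.
  have hE (t : R) : h (s, Num.sqrt s * t + 0) =
      ((s `^ (a - 1) * s ^+ j * expR (- s))%:E *
       (ppowR (a - 1) (1 - t ^+ 2) * (t ^+ 2) ^+ j)%:E)%E.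
    rewrite /h/= addr0 -EFinM; congr EFin.
    have -> : s - (Num.sqrt s * t) ^+ 2 = s * (1 - t ^+ 2).
      by rewrite exprMn sqr_sqrtr ?ltW//; ring.
    by rewrite ppowRM// [(Num.sqrt s * t) ^+ 2]exprMn sqr_sqrtr ?ltW// exprMn; ring.
  under eq_integral do rewrite hE.
  rewrite ge0_integralZl_EFin//; last first.
    by rewrite mulr_ge0 ?expR_ge0// mulr_ge0 ?powR_ge0// exprn_ge0// ltW.
  rewrite -/B muleA -EFinM muleC; congr (_ * _%:E)%E.
  rewrite ppowRE// -powR12_sqrt ?ltW// -(powR_mulrn _ (ltW s0)) !mulrA.
  by rewrite -!powRD ?(gt_eqF s0) ?implybT//; congr (_ `^ _ * _); field.
have e2 : (\int[@lebesgue_measure R]_v \int[@lebesgue_measure R]_s h (s, v) =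
    egamma a * \int[@lebesgue_measure R]_v ((v ^+ 2) ^+ j * expR (- v ^+ 2))%:E)%E.
  rewrite -ge0_integralZl//; last 3 first.
  - apply/measurable_EFinP; apply: measurable_funM.
      by apply: measurable_funX; apply: measurable_funX.
    by apply: measurableT_comp => //; apply: measurableT_comp => //; exact: measurable_funX.
  - by move=> x _; rewrite lee_fin mulr_ge0 ?expR_ge0 ?X0.
  - exact: egamma_ge0.
  apply: eq_integral => v _.
  have mg : measurable_fun [set: R] (fun x : R => (ppowR (a - 1) x * expR (- x))%:E).
    apply/measurable_EFinP; have := @measurable_ppowR_expR R (a - 1) 1.
    by under eq_fun do rewrite mul1r.
  have g0 (x : R) : (0 <= (ppowR (a - 1) x * expR (- x))%:E)%E.
    by rewrite lee_fin mulr_ge0 ?ppowR_ge0 ?expR_ge0.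
  have := @ge0_integral_affine R _ 1 (- v ^+ 2) ltr01 mg g0.
  have mg1 : measurable_fun [set: R] (fun s : R =>
      (ppowR (a - 1) (1 * s - v ^+ 2) * expR (- (1 * s - v ^+ 2)))%:E).
    apply: (measurableT_comp mg).
    by apply: measurable_funD => //; exact: measurable_funM.
  rewrite invr1 mul1e -/(egamma a) => <-; rewrite muleC.
  rewrite -ge0_integralZl_EFin; [|exact: measurableT|by move=> s _; exact: g0
    |exact: mg1|by rewrite mulr_ge0 ?expR_ge0 ?X0].
  apply: eq_integral => s _; rewrite /h/= -EFinM mul1r; congr EFin.
  have -> : expR (- s) = expR (- v ^+ 2) * expR (- (s - v ^+ 2)).
    by rewrite -expRD; congr expR; ring.
  by ring.
have := @fubini_tonelli _ _ _ _ R lebesgue_measure lebesgue_measure h mh h0.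
by rewrite e1 e2 muleC.
Qed.

(** The even moment at a = 1, where the weight is the indicator of (-1, 1) and a primitive is at
    hand. *)
Lemma integral_indic_monomial (R : realType) (j : nat) :
  (\int[@lebesgue_measure R]_t (ppowR 0 (1 - t ^+ 2) * (t ^+ 2) ^+ j)%:E =
   ((j%:R + 2^-1)^-1)%:E)%E.
Proof.
transitivity (\int[@lebesgue_measure R]_(t in `](-1)%R, 1%R[) ((t ^+ (2 * j))%:E))%E.
  rewrite [RHS]integral_mkcond; apply: eq_integral => t _.
  have E : (0 < 1 - t ^+ 2) = (-1 < t < 1).
    by rewrite subr_gt0 -ltr_norml -(real_normK (num_real t)) expr_lt1.
  rewrite /patch mem_setE in_itv/= -E /ppowR; case: ifPn => //=.
    by rewrite powRr0 mul1r exprM.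
  by rewrite mul0r.
have mX : measurable_fun [set: R] (fun t : R => t ^+ (2 * j)).
  exact: measurable_funX.
rewrite integral_itv_obnd_cbnd; last first.
  by apply/measurable_EFinP; exact: measurable_funTS.
rewrite integral_itv_bndo_bndc; last first.
  by apply/measurable_EFinP; exact: measurable_funTS.
have n0 : (2 * j).+1%:R != 0 :> R by rewrite pnatr_eq0.
pose F (t : R) : R := (2 * j).+1%:R^-1 * t ^+ (2 * j).+1.
have dF (t : R) : is_derive t 1 F (t ^+ (2 * j)).
  have dX : is_derive t 1 (fun t : R => t ^+ (2 * j).+1) ((2 * j).+1%:R * t ^+ (2 * j)).
    by apply: DeriveDef; [exact: exprn_derivable|rewrite exp_derive /GRing.scale/= mulr1].
  apply: is_derive_eq; rewrite /GRing.scale/= mulrA.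
  by rewrite mulVf ?mul1r.
have cF (t : R) : {for t, continuous F}.
  by have [/derivable1_diffP/differentiable_continuous] := dF t.
rewrite (@continuous_FTC2 _ _ F).
- rewrite /F !expr1n -EFinB; congr EFin.
  rewrite exprS exprM sqrrN expr1n expr1n -natr1 natrM.
  have -> : j%:R + 2^-1 = (2 * j%:R + 1) / 2 :> R by field.
  by rewrite invf_div; ring.
- lra.
- by apply: continuous_subspaceT => x; exact: exprn_continuous.
- split; first by move=> x _; have [] := dF x.
  + by apply: cvg_at_right_filter; exact: cF.
  + by apply: cvg_at_left_filter; exact: cF.
- by move=> x _; rewrite derive1E; have [_ ->] := dF x.
Qed.

(** At a = 1 the previous identity gives Gamma (j + 3/2) / (j + 1/2), which the recurrence
    collapses. *)
Lemma gauss_moment (R : realType) (j : nat) :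
  (\int[@lebesgue_measure R]_v ((v ^+ 2) ^+ j * expR (- v ^+ 2))%:E =
   (Gamma (j%:R + 2^-1))%:E)%E.
Proof.
have j0 : 0 < j%:R + 2^-1 :> R by rewrite ltr_wpDl.
have := @Gamma_beta_gauss R 1 j ltr01.
rewrite egamma1 mul1e subrr integral_indic_monomial => <-.
rewrite (_ : 1 + j%:R + 2^-1 = j%:R + 2^-1 + 1); last by ring.
rewrite egammaS// -EFin_Gamma// -!EFinM; congr EFin.
by rewrite mulrAC divff ?mul1r// gt_eqF.
Qed.

Lemma Gamma_half (R : realType) : Gamma (2^-1 : R) = Num.sqrt pi.
Proof.
have := @gauss_moment R 0; rewrite add0r.
under eq_integral do rewrite expr0 mul1r.
by rewrite integralT_gauss => -[].
Qed.

(** Here (2j)! cancels the denominator of the cosh series, and 4^j j! becomes that of the Bessel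
    series. *)
Lemma Gamma_half_nat (R : realType) (j : nat) :
  Gamma (j%:R + 2^-1 : R) = Num.sqrt pi * (2 * j)`!%:R / (4 ^+ j * j`!%:R).
Proof.
elim: j => [|j IH]; first by rewrite add0r Gamma_half muln0 expr0 !fact0; field.
rewrite -natr1 addrAC GammaS_gt0; last by rewrite ltr_wpDl.
rewrite IH mulnS !factS exprS !natrM -!natr1 !natrM.
have : (j`!)%:R != 0 :> R by rewrite pnatr_eq0 -lt0n fact_gt0.
have : j%:R + 1 != 0 :> R by rewrite natr1 pnatr_eq0.
have : 4 ^+ j != 0 :> R by rewrite expf_neq0// pnatr_eq0.
by move=> *; field; rewrite ?andbT; do ?[apply/andP; split].
Qed.

Lemma beta_moment (R : realType) (a : R) (j : nat) : 0 < a ->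
  (\int[@lebesgue_measure R]_t (ppowR (a - 1) (1 - t ^+ 2) * (t ^+ 2) ^+ j)%:E =
   (Gamma a * Gamma (j%:R + 2^-1) / Gamma (a + j%:R + 2^-1))%:E)%E.
Proof.
move=> a0; have j0 : 0 < j%:R + 2^-1 :> R by rewrite ltr_wpDl.
have aj0 : 0 < a + j%:R + 2^-1 by rewrite -addrA addr_gt0.
have := @Gamma_beta_gauss R a j a0.
rewrite gauss_moment -!EFin_Gamma// => /(congr1 (mule (Gamma (a + j%:R + 2^-1))^-1%:E)).
rewrite muleA -EFinM mulVf ?gt_eqF ?Gamma_gt0// mul1e => ->.
by rewrite -!EFinM mulrC.
Qed.

(** * Poisson's integral for the Bessel function *)

(** Infinite values matter: Poisson's integral is symmetrised before it is known to be finite. *)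
Lemma half_adde (R : realType) (e : \bar R) : (2^-1%:E * (e + e) = e)%E.
Proof.
case: e => [r| |] /=; first by rewrite -EFinD -EFinM; congr EFin; field.
- by rewrite addye// gt0_muley// lte_fin invr_gt0.
- by rewrite addNye gt0_muleNy// lte_fin invr_gt0.
Qed.

Lemma cosh_series (R : realType) (u : R) :
  (((expR u + expR (- u)) / 2)%:E = \sum_(0 <= j <oo) ((u ^+ 2) ^+ j / (2 * j)`!%:R)%:E)%E.
Proof.
have cv (v : R) : series (exp_coeff v) n @[n --> \oo] --> expR v.
  exact: is_cvg_series_exp_coeff.
have cvu : (series (exp_coeff u) n + series (exp_coeff (- u)) n) / 2 @[n --> \oo] -->
    (expR u + expR (- u)) / 2.
  by apply: cvgMl; apply: cvgD; exact: cv.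
(* Odd terms cancel in the average, so m even terms correspond to 2m terms of the exponential
   series. *)
have sE m : \sum_(0 <= j < m) (u ^+ 2) ^+ j / (2 * j)`!%:R =
    (series (exp_coeff u) (2 * m)%N + series (exp_coeff (- u)) (2 * m)%N) / 2.
  rewrite /series/=; elim: m => [|m IH]; first by rewrite muln0 !big_geq// addr0 mul0r.
  rewrite mulnS !big_nat_recr//= IH /exp_coeff/= -!exprM.
  rewrite (_ : (- u) ^+ (2 * m).+1 = - u ^+ (2 * m).+1); last first.
    by rewrite !exprS !exprM sqrrN; ring.
  rewrite (_ : (- u) ^+ (2 * m) = u ^+ (2 * m)); last by rewrite !exprM sqrrN.
  by rewrite mulNr; move: (u ^+ (2 * m) / _) (u ^+ (2 * m).+1 / _) => A B; field.
apply/esym/cvg_lim => //.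
under eq_fun do rewrite sumEFin sE.
apply: cvg_EFin; first exact: nearW.
apply: (@cvg_comp _ _ _ (fun m => (2 * m)%N) _ _ _ _ _ cvu).
apply/cvgnyPge => A; near=> n.
by rewrite (@leq_trans n)//; [near: n; exact: nbhs_infty_ge | rewrite leq_pmull].
Unshelve. all: by end_near. Qed.

Definition poisson_integral (R : realType) (a x : R) : \bar R :=
  (\int[@lebesgue_measure R]_t (ppowR (a - 1) (1 - t ^+ 2) * expR (- (x * t)))%:E)%E.

Lemma measurable_jacobi_weight (R : realType) (a : R) :
  measurable_fun [set: R] (fun t : R => ppowR (a - 1) (1 - t ^+ 2)).
Proof.
apply: measurableT_comp; first exact: measurable_ppowR.
by apply: measurable_funB => //; apply: measurable_funX.
Qed.

Lemma poisson_integral_ge0 (R : realType) (a x : R) : (0 <= poisson_integral a x)%E.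
Proof.
by apply: integral_ge0 => t _; rewrite lee_fin mulr_ge0 ?ppowR_ge0 ?expR_ge0.
Qed.

(** The symmetry t -> -t replaces the exponential by cosh (x t), all of whose terms are nonnegative;
    sum and integral are then exchanged by monotone convergence. *)
Lemma poisson_integral_series (R : realType) (a x : R) : 0 < a ->
  (poisson_integral a x = \sum_(0 <= j <oo)
    (Num.sqrt pi * Gamma a *
     ((x / 2) ^+ (2 * j) / (j`!%:R * Gamma (a + j%:R + 2^-1))))%:E)%E.
Proof.
move=> a0.
have me (c : R) : measurable_fun [set: R] (fun t : R => expR (c * t)).
  by apply: measurableT_comp => //; exact: measurable_funM.
have mw c : measurable_fun [set: R] (fun t : R =>
    (ppowR (a - 1) (1 - t ^+ 2) * expR (c * t))%:E).
  apply/measurable_EFinP; apply: measurable_funM => //.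
  exact: measurable_jacobi_weight.
have w0 (c t : R) : (0 <= (ppowR (a - 1) (1 - t ^+ 2) * expR (c * t))%:E)%E.
  by rewrite lee_fin mulr_ge0 ?ppowR_ge0 ?expR_ge0.
have PE : poisson_integral a x =
    (\int[@lebesgue_measure R]_t (ppowR (a - 1) (1 - t ^+ 2) * expR ((- x) * t))%:E)%E.
  by apply: eq_integral => t _; rewrite mulNr.
have PN : poisson_integral a x =
    (\int[@lebesgue_measure R]_t (ppowR (a - 1) (1 - t ^+ 2) * expR (x * t))%:E)%E.
  rewrite -(ge0_integral_opp (mw x) (w0 x)).
  by apply: eq_integral => t _; rewrite sqrrN mulrN.
have X0 (v : R) j : 0 <= (v ^+ 2) ^+ j by apply: exprn_ge0; exact: sqr_ge0.
have h0 : 0 <= 2^-1 :> R by rewrite invr_ge0.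
transitivity (\int[@lebesgue_measure R]_t
   (ppowR (a - 1) (1 - t ^+ 2) * ((expR (x * t) + expR (- (x * t))) / 2))%:E)%E.
  transitivity (2^-1%:E * (poisson_integral a x + poisson_integral a x))%E.
    by rewrite half_adde.
  rewrite {1}PN PE -ge0_integralD; [|exact: measurableT|by move=> t _; exact: w0
    |exact: mw|by move=> t _; exact: w0|exact: mw].
  rewrite -ge0_integralZl_EFin; [|exact: measurableT
    |by move=> t _; apply: adde_ge0; exact: w0
    |by apply: emeasurable_funD; exact: mw|exact: h0].
  apply: eq_integral => t _; rewrite -EFinD -EFinM mulNr; congr EFin; ring.
transitivity (\int[@lebesgue_measure R]_t (\sum_(0 <= j <oo)
    (x ^+ (2 * j) / (2 * j)`!%:R)%:E * (ppowR (a - 1) (1 - t ^+ 2) * (t ^+ 2) ^+ j)%:E))%E.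
  apply: eq_integral => t _; rewrite EFinM cosh_series -nneseriesZl; last first.
    by move=> j _; rewrite lee_fin; exact: (divr_ge0 (X0 _ _) (ler0n _ _)).
  apply: eq_eseriesr => j _; rewrite -!EFinM; congr EFin.
  by rewrite [(x * t) ^+ 2]exprMn [(_ * _) ^+ j]exprMn exprM; ring.
have c0 j : 0 <= x ^+ (2 * j) / (2 * j)`!%:R by rewrite exprM divr_ge0.
have mB j : measurable_fun [set: R]
    (fun t : R => (ppowR (a - 1) (1 - t ^+ 2) * (t ^+ 2) ^+ j)%:E).
  apply/measurable_EFinP; apply: measurable_funM.
    exact: measurable_jacobi_weight.
  by apply: measurable_funX; apply: measurable_funX.
have B0 j (t : R) : (0 <= (ppowR (a - 1) (1 - t ^+ 2) * (t ^+ 2) ^+ j)%:E)%E.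
  by rewrite lee_fin mulr_ge0 ?ppowR_ge0.
rewrite integral_nneseries; [|exact: measurableT
  |by move=> j; apply: measurable_funeM; exact: mB
  |by move=> j t _; apply: mule_ge0; [rewrite lee_fin; exact: c0|exact: B0]].
apply: eq_eseriesr => j _.
rewrite ge0_integralZl_EFin; [|exact: measurableT|by move=> t _; exact: B0
  |exact: mB|exact: c0].
rewrite beta_moment// -EFinM; congr EFin; rewrite Gamma_half_nat.
rewrite expr_div_n (exprM 2) (_ : 2 ^+ 2 = 4 :> R); last by ring.
have : (j`!)%:R != 0 :> R by rewrite pnatr_eq0 -lt0n fact_gt0.
have : ((2 * j)`!)%:R != 0 :> R by rewrite pnatr_eq0 -lt0n fact_gt0.
have : 4 ^+ j != 0 :> R by rewrite expf_neq0// pnatr_eq0.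
have : Gamma (a + j%:R + 2^-1) != 0.
  by rewrite gt_eqF// Gamma_gt0// -addrA addr_gt0// ltr_wpDl.
by move=> *; field; do ?[apply/andP; split].
Qed.

(** On the support |t| < 1 the exponential is at most e^x, which leaves the moment j = 0. *)
Lemma poisson_integral_fin_num (R : realType) (a x : R) : 0 < a -> 0 < x ->
  poisson_integral a x \is a fin_num.
Proof.
move=> a0 x0; rewrite ge0_fin_numE ?poisson_integral_ge0//.
have B := @beta_moment R a 0 a0.
apply: (@le_lt_trans _ _ ((expR x)%:E *
    (Gamma a * Gamma (0%:R + 2^-1) / Gamma (a + 0%:R + 2^-1))%:E)%E); last first.
  by rewrite -EFinM ltry.
rewrite -B -ge0_integralZl_EFin//; last 2 first.
- by move=> t _; rewrite expr0 mulr1 lee_fin ppowR_ge0.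
- apply/measurable_EFinP; under eq_fun do rewrite expr0 mulr1.
  exact: measurable_jacobi_weight.
apply: ge0_le_integral => //.
- by move=> t _; rewrite lee_fin mulr_ge0 ?ppowR_ge0 ?expR_ge0.
- apply/measurable_EFinP; apply: measurable_funM; first exact: measurable_jacobi_weight.
  by apply: measurableT_comp => //; apply: measurableT_comp => //; exact: measurable_funM.
- apply: measurable_funeM; apply/measurable_EFinP.
  under eq_fun do rewrite expr0 mulr1.
  exact: measurable_jacobi_weight.
move=> t _; rewrite -EFinM lee_fin expr0 mulr1 mulrC.
have [|t1] := leP (1 - t ^+ 2) 0; first by move=> ?; rewrite ppowR_le0// !mulr0.
apply: ler_wpM2r; first exact: ppowR_ge0.
rewrite ler_expR; nra.
Qed.

(** Stated as convergence of the partial sums: besides the value of [besselI], this yields its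
    measurability as a pointwise limit. *)
Lemma besselI_poisson (R : realType) (a x : R) : 0 < a -> 0 < x ->
  series (fun k : nat => (x / 2) `^ ((2 * k)%:R + (a - 2^-1)) /
    (k`!%:R * Gamma (k%:R + 1 + (a - 2^-1)))) @ \oo -->
  (x / 2) `^ (a - 2^-1) / (Num.sqrt pi * Gamma a) * fine (poisson_integral a x).
Proof.
move=> a0 x0; have x20 : 0 < x / 2 by rewrite divr_gt0.
pose c j := Num.sqrt pi * Gamma a *
     ((x / 2) ^+ (2 * j) / (j`!%:R * Gamma (a + j%:R + 2^-1))).
have G0 j : 0 < Gamma (a + j%:R + 2^-1).
  by rewrite Gamma_gt0// -addrA addr_gt0// ltr_wpDl.
have c0 j : (0 <= (c j)%:E)%E.
  rewrite lee_fin; apply: mulr_ge0.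
    by rewrite mulr_ge0 ?sqrtr_ge0// ltW// Gamma_gt0.
  apply: divr_ge0; first exact/exprn_ge0/ltW.
  by apply: mulr_ge0; [exact: ler0n|exact: ltW].
have sqpi0 : Num.sqrt pi != 0 :> R by rewrite gt_eqF// sqrtr_gt0 pi_gt0.
have Ga0 : Gamma a != 0 by rewrite gt_eqF// Gamma_gt0.
have cvc : series c @ \oo --> fine (poisson_integral a x).
  suff /fine_cvg : (series c n)%:E @[n --> \oo] --> (fine (poisson_integral a x))%:E by [].
  rewrite fineK ?poisson_integral_fin_num// poisson_integral_series//.
  have := @is_cvg_nneseries R (fun j => (c j)%:E) predT 0 (fun j _ _ => c0 j).
  by under eq_cvg do rewrite sumEFin.
rewrite (_ : series _ = (fun n =>
    (x / 2) `^ (a - 2^-1) / (Num.sqrt pi * Gamma a) * series c n)).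
  by apply: cvgMr.
apply/funext => n; rewrite /series/= big_distrr/=; apply: eq_bigr => k _.
rewrite [in LHS]powRD ?(gt_eqF x20) ?implybT// (powR_mulrn _ (ltW x20)) /c.
rewrite (_ : k%:R + 1 + (a - 2^-1) = a + k%:R + 2^-1); last by field.
have : (k`!)%:R != 0 :> R by rewrite pnatr_eq0 -lt0n fact_gt0.
have := G0 k; move: (Gamma (a + _ + _)) => g g0.
have gN : g != 0 by rewrite gt_eqF.
by move=> *; field; do ?[apply/andP; split].
Qed.

(** * The binomial series with remainder *)

Definition gbinomial (R : realType) (b : R) (k : nat) : R :=
  (\prod_(i < k) (b - i%:R)) / k`!%:R.

Lemma gbinomial0 (R : realType) (b : R) : gbinomial b 0 = 1.
Proof. by rewrite /gbinomial big_ord0 fact0 divr1. Qed.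

Lemma gbinomialS (R : realType) (b : R) (k : nat) :
  k.+1%:R * gbinomial b k.+1 = b * gbinomial (b - 1) k.
Proof.
rewrite /gbinomial big_ord_recl subr0 factS natrM.
have -> : \prod_(i < k) (b - (bump 0 i)%:R) = \prod_(i < k) (b - 1 - i%:R).
  by apply: eq_bigr => i _; rewrite /bump/= natrD opprD addrA.
have : k.+1%:R != 0 :> R by rewrite pnatr_eq0.
have : (k`!)%:R != 0 :> R by rewrite pnatr_eq0 -lt0n fact_gt0.
by move: (\prod_(i < k) _) (k.+1%:R : R) => P m *; field; do ?[apply/andP; split].
Qed.

(** By induction: passing from 1 / Gamma (a - k) to 1 / Gamma (a - k - 1) produces the factor a - 1
    - k. The poles are no exception: for integer a both sides are 0 once k >= a. *)
Lemma gbinomial_Gamma (R : realType) (a : R) (k : nat) : 0 < a ->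
  gbinomial (a - 1) k / Gamma a = (k`!%:R * Gamma (a - k%:R))^-1.
Proof.
move=> a0; rewrite /gbinomial [RHS]invfM [RHS]mulrC mulrAC; congr (_ * _).
elim: k => [|k IH]; first by rewrite big_ord0 mul1r subr0.
rewrite big_ord_recr/= mulrAC IH [RHS]GammaV mulrC; congr (_ * (Gamma _)^-1);
by rewrite -natr1; ring.
Qed.

Lemma is_derive_binomial_sum (R : realType) (b u : R) (N : nat) :
  is_derive u 1 (fun u : R => \sum_(k < N.+1) gbinomial b k * (- u) ^+ k)
    (- (b * \sum_(k < N) gbinomial (b - 1) k * (- u) ^+ k)).
Proof.
have E : (fun u : R => \sum_(k < N.+1) gbinomial b k * (- u) ^+ k) =
    \sum_(k < N.+1) (fun u : R => gbinomial b k * (- u) ^+ k).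
  by apply/funext => v; rewrite fct_sumE.
have D k : is_derive u 1 (fun u : R => gbinomial b k * (- u) ^+ k)
    (- (gbinomial b k * (k%:R * (- u) ^+ k.-1))).
  have dN : is_derive u 1 (fun u : R => - u) (-1) by apply: is_derive_eq.
  have := @is_deriveX R R (fun u : R => - u) k u 1 (-1) dN.
  rewrite (_ : (fun u : R => - u) ^+ k = (fun u => (- u) ^+ k)) => [dX|]; last first.
    by apply/funext => v; rewrite exprfctE.
  by apply: is_derive_eq; rewrite /GRing.scale/=; ring.
rewrite E; apply: is_derive_eq.
rewrite big_ord_recl/= mul0r mulr0 oppr0 add0r mulr_sumr -sumrN.
apply: eq_bigr => k _; rewrite /bump/= add1n add0n.
by rewrite mulrCA mulrA (mulrA b) -gbinomialS.
Qed.

(* The derivative of the N.+1-st remainder for b is -b times the N-th remainder for b - 1. *)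
Lemma binomial_remainder (R : realType) (N : nat) (b : R) :
  exists2 C : R, 0 <= C & forall u : R, 0 <= u <= 2^-1 ->
    `|(1 - u) `^ b - \sum_(k < N) gbinomial b k * (- u) ^+ k| <= C * u ^+ N.
Proof.
elim: N b => [|N IH] b.
  (* As 1 - u lies in [1/2, 1], its power b is at most its power -|b|, hence at most 2^|b|. *)
  exists (2 `^ `|b|); first exact: powR_ge0.
  move=> u /andP[u0 u2]; rewrite big_ord0 subr0 expr0 mulr1 ger0_norm ?powR_ge0//.
  have v0 : 0 < 1 - u by lra.
  apply: (@le_trans _ _ ((1 - u) `^ (- `|b|))).
    apply: ger_powR; first by apply/andP; split => //; lra.
    by rewrite lerNl -normrN ler_norm.
  have -> : (1 - u) `^ (- `|b|) = (1 - u)^-1 `^ `|b|.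
    by rewrite -powR_inv1 ?ltW// -powRrM mulN1r.
  apply: ge0_ler_powR => //; rewrite ?nnegrE ?invr_ge0 ?(ltW v0)//.
  by rewrite -[leRHS]invrK lef_pV2 ?posrE ?invr_gt0//; lra.
have [C C0 HC] := IH (b - 1).
exists (`|b| * C); first exact: mulr_ge0.
move=> u /andP[u0 u2].
pose f (u : R) := (1 - u) `^ b - \sum_(k < N.+1) gbinomial b k * (- u) ^+ k.
pose df (u : R) := - (b * ((1 - u) `^ (b - 1) - \sum_(k < N) gbinomial (b - 1) k * (- u) ^+ k)).
have dff (v : R) : v < 1 -> is_derive v 1 f (df v).
  move=> v1; have v0 : 0 < 1 - v by lra.
  have d1 := is_derive1_powR b v0.
  have d2 : is_derive v 1 (fun x : R => 1 - x) (- 1).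
    by apply: is_derive_eq; rewrite /GRing.scale/=; ring.
  have d3 : is_derive v 1 (fun x : R => (1 - x) `^ b) (b * (1 - v) `^ (b - 1) * (- 1)).
    exact: (@is_derive1_comp _ (fun x : R => x `^ b) (fun x : R => 1 - x) v _ _ d1 d2).
  have d4 := is_derive_binomial_sum b v N.
  by rewrite /f /df; apply: is_derive_eq; rewrite /GRing.scale/=; ring.
have f0 : f 0 = 0.
  rewrite /f subr0 powR1 big_ord_recl gbinomial0 expr0 mulr1.
  rewrite big1 ?addr0 ?subrr// => k _; rewrite oppr0 expr0n/=.
  by rewrite mulr0.
have cf : {within `[0, u], continuous f}.
  apply: derivable_within_continuous => x; rewrite in_itv/= => /andP[_ xu].
  by have [] : is_derive x 1 f (df x) by apply: dff; lra.
have dfu (x : R) : x \in `]0, u[ -> is_derive x 1 f (df x).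
  by rewrite in_itv/= => /andP[_ xu]; apply: dff; lra.
(* Since f vanishes at 0, |f u| = u |df c| with c < u, which supplies the missing power of u. *)
have [c] := MVT_segment u0 dfu cf.
rewrite in_itv/= => /andP[c0 cu]; rewrite f0 !subr0 -/(f u) => ->.
rewrite normrM (ger0_norm u0) exprSr mulrA ler_wpM2r// normrN normrM -mulrA.
apply: ler_wpM2l => //; apply: le_trans (HC c _) _; first by apply/andP; split; lra.
by apply: ler_wpM2l => //; rewrite lerXn2r// nnegrE.
Qed.

(* For s > 1 the factor (2 - s)_+^b may be unbounded near s = 2 and stays in the bound. *)
Lemma binomial_remainder_global (R : realType) (N : nat) (b : R) :
  exists2 K : R, 0 <= K & forall s : R, 0 < s ->
    `|ppowR b (2 - s) - \sum_(k < N) 2 `^ b * gbinomial b k * (- 2^-1) ^+ k * s ^+ k|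
      <= K * (s ^+ N * (1 + ppowR 0 (s - 1) * ppowR b (2 - s))).
Proof.
have [C C0 HC] := binomial_remainder N b.
pose S := \sum_(k < N) `|2 `^ b * gbinomial b k * (- 2^-1) ^+ k|.
have S0 : 0 <= S by apply: sumr_ge0.
have p2 : 0 <= 2 `^ b by exact: powR_ge0.
(* The three summands pay for the Taylor remainder in s / 2 when s <= 1, for the polynomial when s >
   1, and for (2 - s)_+^b itself when s > 1. *)
exists (2 `^ b * C + S + 1); first by rewrite !addr_ge0// mulr_ge0.
move=> s s0; have [s1|s1] := leP s 1.
  rewrite (ppowR_le0 0) ?subr_le0// mul0r addr0 mulr1 ppowRE; last by lra.
  have u2 : 0 <= s / 2 <= 2^-1 by apply/andP; split; lra.
  have -> : 2 - s = 2 * (1 - s / 2) by field.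
  rewrite powRM//; last by lra.
  have -> : \sum_(k < N) 2 `^ b * gbinomial b k * (- 2^-1) ^+ k * s ^+ k =
      2 `^ b * \sum_(k < N) gbinomial b k * (- (s / 2)) ^+ k.
    rewrite mulr_sumr; apply: eq_bigr => k _.
    by rewrite -!mulrA -exprMn mulNr (mulrC 2^-1).
  rewrite -mulrBr normrM (ger0_norm p2).
  apply: le_trans (ler_wpM2l p2 (HC _ u2)) _.
  rewrite mulrA; apply: ler_pM; rewrite ?mulr_ge0 ?exprn_ge0//; try lra.
  by rewrite lerXn2r ?nnegrE//; lra.
rewrite (ppowRE 0) ?subr_gt0// powRr0 mul1r.
have q0 := @ppowR_ge0 R b (2 - s).
have sN : 1 <= s ^+ N by rewrite exprn_ege1// ltW.
have SB : `|\sum_(k < N) 2 `^ b * gbinomial b k * (- 2^-1) ^+ k * s ^+ k| <= S * s ^+ N.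
  apply: le_trans (ler_norm_sum _ _ _) _; rewrite mulr_suml; apply: ler_sum => k _.
  rewrite normrM; apply: ler_wpM2l => //; rewrite ger0_norm ?exprn_ge0 ?(ltW s0)//.
  by apply: ler_weXn2l; [exact: ltW|exact/ltnW/ltn_ord].
apply: le_trans (ler_normB _ _) _; rewrite (ger0_norm q0).
have CP : 0 <= 2 `^ b * C by exact: mulr_ge0.
move: SB q0 sN CP; set q := ppowR _ _; set m := s ^+ N; set T := `| _ |; set D := _ * C.
move=> SB q0 m1 D0.
have mq : q <= m * q by rewrite ler_peMl.
have A1 : 0 <= D * (m * (1 + q)) by rewrite !mulr_ge0//; lra.
have A2 : 0 <= S * (m * q) by rewrite !mulr_ge0//; lra.
by lra.
Qed.

(** * Integrability and estimates for real-valued integrals *)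

Lemma integrable_EFin_sum d (T : measurableType d) (R : realType)
    (mu : {measure set T -> \bar R}) (D : set T) (N : nat) (f : nat -> T -> R) :
  measurable D -> (forall k, mu.-integrable D (EFin \o f k)) ->
  mu.-integrable D (EFin \o (fun x => \sum_(k < N) f k x)).
Proof.
move=> mD fi.
have := @integrable_sum _ _ _ mu D mD _ (index_enum 'I_N) predT
  (fun k : 'I_N => EFin \o f k) (fun k _ => fi k).
by apply: eq_integrable => // x _ /=; rewrite sumEFin.
Qed.

Lemma Rintegral_sum d (T : measurableType d) (R : realType)
    (mu : {measure set T -> \bar R}) (D : set T) (N : nat) (f : nat -> T -> R) :
  measurable D -> (forall k, mu.-integrable D (EFin \o f k)) ->
  (\int[mu]_(x in D) (\sum_(k < N) f k x))%R = \sum_(k < N) (\int[mu]_(x in D) f k x)%R.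
Proof.
move=> mD fi; elim: N => [|N IH].
  under eq_Rintegral do rewrite big_ord0.
  by rewrite big_ord0 /Rintegral integral0.
under eq_Rintegral do rewrite big_ord_recr.
rewrite big_ord_recr/= -IH; apply: RintegralD => //.
exact: integrable_EFin_sum.
Qed.

(** The bridge from values computed in [0, +oo] to real integrals: for a nonnegative measurable
    function a finite value amounts to integrability. *)
Lemma ge0_integrable_EFin d (T : measurableType d) (R : realType)
    (mu : {measure set T -> \bar R}) (D : set T) (f : T -> R) (r : R) :
  measurable D -> measurable_fun D f -> (forall x, D x -> 0 <= f x) ->
  (\int[mu]_(x in D) (f x)%:E = r%:E)%E ->
  mu.-integrable D (EFin \o f) /\ (\int[mu]_(x in D) f x)%R = r.
Proof.
move=> mD mf f0 fr; split; last by rewrite /Rintegral fr.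
apply/integrableP; split; first exact/measurable_EFinP.
rewrite (eq_integral (EFin \o f)) ?fr ?ltry// => x /set_mem/f0 fx0 /=.
by rewrite ger0_norm.
Qed.

(** Turns a pointwise remainder into a remainder of integrals, both for the Laplace integral in s
    and for the tail in x. *)
Lemma dist_Rintegral_le d (T : measurableType d) (R : realType)
    (mu : {measure set T -> \bar R}) (D : set T) (f g h : T -> R) :
  measurable D -> mu.-integrable D (EFin \o f) -> mu.-integrable D (EFin \o g) ->
  mu.-integrable D (EFin \o h) -> (forall x, D x -> `|f x - g x| <= h x) ->
  `|(\int[mu]_(x in D) f x)%R - (\int[mu]_(x in D) g x)%R| <= (\int[mu]_(x in D) h x)%R.
Proof.
move=> mD fi gi hi fgh; rewrite -RintegralB//.
have fgi : mu.-integrable D (EFin \o (fun x => f x - g x)).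
  have := integrableB mD fi gi.
  by apply: eq_integrable => // x _ /=; rewrite EFinB.
apply: le_trans (le_normr_Rintegral mD fgi) _.
apply: le_Rintegral => //.
have := integrable_abse fgi.
by apply: eq_integrable.
Qed.

(** * Watson's lemma for Poisson's integral *)

Lemma measurable_watson (R : realType) (a x : R) :
  measurable_fun [set: R]
    (fun s : R => ppowR (a - 1) s * ppowR (a - 1) (2 - s) * expR (- (x * s))).
Proof.
apply: measurable_funM.
  apply: measurable_funM; first exact: measurable_ppowR.
  apply: measurableT_comp; first exact: measurable_ppowR.
  exact: measurable_funB.
by apply: measurableT_comp => //; apply: measurableT_comp.
Qed.

Lemma poisson_watson (R : realType) (a x : R) : 0 < a -> 0 < x ->
  (\int[@lebesgue_measure R]_s
     (ppowR (a - 1) s * ppowR (a - 1) (2 - s) * expR (- (x * s)))%:E =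
   (expR (- x) * fine (poisson_integral a x))%:E)%E.
Proof.
move=> a0 x0; rewrite EFinM fineK ?poisson_integral_fin_num//.
have mP : measurable_fun [set: R] (fun t : R =>
    (ppowR (a - 1) (1 - t ^+ 2) * expR (- (x * t)))%:E).
  apply/measurable_EFinP; apply: measurable_funM; first exact: measurable_jacobi_weight.
  by apply: measurableT_comp => //; apply: measurableT_comp.
have P0 (t : R) : (0 <= (ppowR (a - 1) (1 - t ^+ 2) * expR (- (x * t)))%:E)%E.
  by rewrite lee_fin mulr_ge0 ?ppowR_ge0 ?expR_ge0.
have := @ge0_integral_affine R _ 1 (- 1) ltr01 mP P0.
rewrite invr1 mul1e -/(poisson_integral a x) => <-.
have mP1 : measurable_fun [set: R] (fun s : R =>
    (ppowR (a - 1) (1 - (1 * s - 1) ^+ 2) * expR (- (x * (1 * s - 1))))%:E).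
  apply: (measurableT_comp mP).
  by apply: measurable_funD => //; exact: measurable_funM.
rewrite -ge0_integralZl_EFin; [|exact: measurableT|by move=> s _; exact: P0
  |exact: mP1|exact: expR_ge0].
apply: eq_integral => s _; rewrite -EFinM mul1r; congr EFin.
have -> : expR (- (x * s)) = expR (- x) * expR (- (x * (s - 1))).
  by rewrite -expRD; congr expR; ring.
rewrite [RHS]mulrCA; congr (_ * _).
have -> : 1 - (s - 1) ^+ 2 = s * (2 - s) by ring.
(* Cut-off powers are not multiplicative on two negative factors; here s <= 0 forces 2 - s > 0, so
   both sides vanish. *)
have [s0|s0] := ltP 0 s; first by rewrite ppowRM// ppowRE.
rewrite (ppowR_le0 _ s0) mul0r ppowR_le0// mulr_le0_ge0//; lra.
Qed.

(** The part s^N of the remainder integrates to a Gamma value times x^(-a-N). For s > 1 the bound on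
    (x s)^(a+N) e^(-xs) gives s^(a+N-1) e^(-xs) <= C1 x^(-a-N), the same order, and the remaining (2
    - s)_+^(a-1) is integrable on (1, 2). *)
Lemma watson_remainder (R : realType) (a : R) (N : nat) : 0 < a ->
  exists2 C : R, 0 <= C & forall x : R, 0 < x ->
    `|expR (- x) * fine (poisson_integral a x) -
      \sum_(k < N) 2 `^ (a - 1) * gbinomial (a - 1) k * (- 2^-1) ^+ k *
        (x `^ (- (a + k%:R)) * Gamma (a + k%:R))|
    <= C * x `^ (- (a + N%:R)).
Proof.
move=> a0.
have [K K0 HK] := binomial_remainder_global N (a - 1).
have aN k : 0 < a + k%:R :> R by rewrite ltr_wpDr.
have [C1 /ltW C10 HC1] := powR_expR_bounded (ltW (aN N)).
have Ga0 := ltW (Gamma_gt0 a0).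
have CE0 : 0 <= C1 * expR 1 by apply: mulr_ge0 => //; exact: expR_ge0.
pose b k : R := 2 `^ (a - 1) * gbinomial (a - 1) k * (- 2^-1) ^+ k.
exists (K * (Gamma (a + N%:R) + C1 * expR 1 * Gamma a)).
  apply: mulr_ge0 => //; apply: addr_ge0; first exact/ltW/Gamma_gt0.
  by apply: mulr_ge0 => //; exact: CE0.
move=> x x0.
pose F (s : R) := ppowR (a - 1) s * ppowR (a - 1) (2 - s) * expR (- (x * s)).
pose G k (s : R) := ppowR (a + k%:R - 1) s * expR (- (x * s)).
(* The reflected Gamma integrand, of total mass Gamma a. It dominates (2 - s)_+^(a-1) on s > 1 at
   the price of a factor e, whence [expR 1] in the constant. *)
pose Q (s : R) := ppowR (a - 1) (2 - s) * expR (- (2 - s)).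
have [Fi FE] := @ge0_integrable_EFin _ _ R lebesgue_measure setT F _ measurableT
  (measurable_watson a x)
  (fun s _ => mulr_ge0 (mulr_ge0 (ppowR_ge0 _ _) (ppowR_ge0 _ _)) (expR_ge0 _))
  (poisson_watson a0 x0).
have GiE k : lebesgue_measure.-integrable [set: R] (EFin \o G k) /\
    (\int[lebesgue_measure]_s G k s)%R = x `^ (- (a + k%:R)) * Gamma (a + k%:R).
  apply: ge0_integrable_EFin => //; first exact: measurable_ppowR_expR.
    by move=> s _; rewrite mulr_ge0 ?ppowR_ge0 ?expR_ge0.
  by rewrite egamma_scale// EFinM EFin_Gamma.
have [Qi QE] : lebesgue_measure.-integrable [set: R] (EFin \o Q) /\
    (\int[lebesgue_measure]_s Q s)%R = Gamma a.
  have mE : measurable_fun [set: R] (fun s : R => (ppowR (a - 1) s * expR (- s))%:E).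
    apply/measurable_EFinP; have := @measurable_ppowR_expR R (a - 1) 1.
    by under eq_fun do rewrite mul1r.
  have E0 (s : R) : (0 <= (ppowR (a - 1) s * expR (- s))%:E)%E.
    by rewrite lee_fin mulr_ge0 ?ppowR_ge0 ?expR_ge0.
  apply: ge0_integrable_EFin => //.
  - move/measurable_EFinP in mE; apply: (measurableT_comp mE).
    exact: measurable_funB.
  - by move=> s _; rewrite mulr_ge0 ?ppowR_ge0 ?expR_ge0.
  have mE1 : measurable_fun [set: R] (fun s : R =>
      (ppowR (a - 1) (1 * s + 2) * expR (- (1 * s + 2)))%:E).
    by apply: (measurableT_comp mE); apply: measurable_funD => //; exact: measurable_funM.
  have := ge0_integral_affine 2 ltr01 mE E0.
  rewrite invr1 mul1e -/(egamma a) -EFin_Gamma// => <-.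
  rewrite -(ge0_integral_opp mE1 (fun s => E0 (1 * s + 2))).
  by apply: eq_integral => s _; rewrite /Q mul1r (addrC (- s)).
pose H (s : R) := K * (G N s + C1 * expR 1 * x `^ (- (a + N%:R)) * Q s).
have HiE : lebesgue_measure.-integrable [set: R] (EFin \o H) /\
    (\int[lebesgue_measure]_s H s)%R =
    K * (Gamma (a + N%:R) + C1 * expR 1 * Gamma a) * x `^ (- (a + N%:R)).
  have [Gi GE] := GiE N.
  have i1 : lebesgue_measure.-integrable [set: R]
      (EFin \o (fun s => C1 * expR 1 * x `^ (- (a + N%:R)) * Q s)).
    have := integrableZl measurableT (C1 * expR 1 * x `^ (- (a + N%:R))) Qi.
    by apply: eq_integrable => // s _ /=; rewrite EFinM.
  have i2 : lebesgue_measure.-integrable [set: R]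
      (EFin \o (fun s => G N s + C1 * expR 1 * x `^ (- (a + N%:R)) * Q s)).
    have := integrableD measurableT Gi i1.
    by apply: eq_integrable => // s _ /=; rewrite EFinD.
  split.
    have := integrableZl measurableT K i2.
    by apply: eq_integrable => // s _ /=; rewrite EFinM.
  rewrite RintegralZl// RintegralD// RintegralZl// GE QE; ring.
pose bG k (s : R) := b k * G k s.
have bGi k : lebesgue_measure.-integrable [set: R] (EFin \o bG k).
  have := integrableZl measurableT (b k) (GiE k).1.
  by apply: eq_integrable => // s _ /=; rewrite EFinM.
have -> : \sum_(k < N) 2 `^ (a - 1) * gbinomial (a - 1) k * (- 2^-1) ^+ k *
        (x `^ (- (a + k%:R)) * Gamma (a + k%:R)) =
    (\int[lebesgue_measure]_s \sum_(k < N) bG k s)%R.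
  transitivity (\sum_(k < N) (\int[lebesgue_measure]_s bG k s)%R).
    apply: eq_bigr => k _; have [Gi GE] := GiE k.
    by rewrite -GE; exact: (esym (RintegralZl (b k) measurableT Gi)).
  exact/esym/Rintegral_sum.
rewrite -FE -HiE.2; apply: dist_Rintegral_le => //.
- exact: integrable_EFin_sum.
- exact: HiE.1.
move=> s _; have [s0|s0] := leP s 0.
  rewrite /F ppowR_le0// !mul0r sub0r big1 ?oppr0 ?normr0; last first.
    by move=> k _; rewrite /bG /G ppowR_le0// mul0r mulr0.
  rewrite /H mulr_ge0// addr_ge0//; first by rewrite /G ppowR_le0// mul0r.
  apply: mulr_ge0; first by apply: mulr_ge0 => //; exact: powR_ge0.
  exact: mulr_ge0 (ppowR_ge0 _ _) (expR_ge0 _).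
have GE k : G k s = ppowR (a - 1) s * expR (- (x * s)) * s ^+ k.
  by rewrite mulrAC ppowRX /G; congr (ppowR _ _ * _); ring.
have -> : F s - \sum_(k < N) bG k s =
  ppowR (a - 1) s * expR (- (x * s)) * (ppowR (a - 1) (2 - s) - \sum_(k < N) b k * s ^+ k).
  rewrite mulrBr /F mulrAC mulr_sumr; congr (_ - _); apply: eq_bigr => k _.
  by rewrite /bG GE mulrCA.
have w0 : 0 <= ppowR (a - 1) s * expR (- (x * s)).
  by rewrite mulr_ge0 ?ppowR_ge0 ?expR_ge0.
rewrite normrM (ger0_norm w0).
apply: le_trans (ler_wpM2l w0 (HK s s0)) _.
rewrite mulrCA /H; apply: ler_wpM2l => //.
rewrite mulrA -GE mulrDr mulr1 lerD2l.
have [s1|s1] := leP s 1.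
  rewrite (ppowR_le0 0) ?subr_le0// mul0r mulr0.
  apply: mulr_ge0; first by apply: mulr_ge0 => //; exact: powR_ge0.
  exact: mulr_ge0 (ppowR_ge0 _ _) (expR_ge0 _).
rewrite (ppowRE 0) ?subr_gt0// powRr0 mul1r /Q.
have GB : G N s <= C1 * x `^ (- (a + N%:R)).
  have xs0 : 0 < x * s by exact: mulr_gt0.
  have := HC1 _ xs0; rewrite powRM ?(ltW x0) ?(ltW s0)// => HH.
  rewrite /G ppowRE// powRN ler_pdivlMr ?powR_gt0//.
  apply: le_trans HH; rewrite mulrC mulrA; apply: ler_wpM2r; first exact: expR_ge0.
  apply: ler_wpM2l; first exact: powR_ge0.
  by apply: ler_powR; [exact: ltW|rewrite gerBl].
have [s2|s2] := leP (2 - s) 0; first by rewrite ppowR_le0// !mul0r !mulr0.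
have e1 : 1 <= expR 1 * expR (- (2 - s)).
  by rewrite -expRD -[leLHS]expR0 ler_expR; lra.
have q0 := @ppowR_ge0 R (a - 1) (2 - s).
have -> : C1 * expR 1 * x `^ (- (a + N%:R)) * (ppowR (a - 1) (2 - s) * expR (- (2 - s))) =
  (C1 * x `^ (- (a + N%:R)) * ppowR (a - 1) (2 - s)) * (expR 1 * expR (- (2 - s))) by ring.
apply: le_trans (ler_wpM2r q0 GB) _.
by apply: ler_peMr => //; apply: mulr_ge0 => //; apply: mulr_ge0 => //; exact: powR_ge0.
Qed.

(** * Expansion of the integrand *)

(** The powers of 2 collapse to 2^(1/2-a) 2^(a-1) = 2^(-1/2), which joins sqrt pi in 1 / sqrt (2
    pi); Gamma a cancels against the binomial coefficient and leaves 1 / Gamma (a - k). *)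
Lemma besselI_coef (R : realType) (a : R) (k : nat) : 0 < a ->
  (2^-1) `^ (a - 2^-1) / (Num.sqrt pi * Gamma a) *
    (2 `^ (a - 1) * gbinomial (a - 1) k * (- 2^-1) ^+ k) =
  (-1) ^+ k / (Gamma (a - k%:R) * k`!%:R) * 2 ^- k / Num.sqrt (2 * pi).
Proof.
move=> a0; have Ga : Gamma a != 0 by rewrite gt_eqF ?Gamma_gt0.
have H : gbinomial (a - 1) k = Gamma a * (k`!%:R * Gamma (a - k%:R))^-1.
  by rewrite -gbinomial_Gamma//; field.
have H2 : (2^-1) `^ (a - 2^-1) * 2 `^ (a - 1) = (Num.sqrt 2)^-1.
  rewrite -[X in X `^ (a - 2^-1) * _](powR_inv1 (ler0n R 2)) -powRrM -powRD; last first.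
    by rewrite pnatr_eq0 implybT.
  rewrite (_ : -1 * (a - 2^-1) + (a - 1) = - 2^-1); last by field.
  by rewrite powRN powR12_sqrt.
have -> : (- 2^-1) ^+ k = (-1) ^+ k * 2 ^- k :> R by rewrite -exprVn -exprMn mulN1r.
have -> : (Num.sqrt (2 * pi))^-1 =
    (2^-1) `^ (a - 2^-1) * 2 `^ (a - 1) / Num.sqrt pi :> R.
  by rewrite sqrtrM// invfM -H2.
rewrite H; move: (Gamma a) Ga (Gamma (a - k%:R)) => G G0 g.
rewrite !invfM.
transitivity (G / G * ((2^-1) `^ (a - 2^-1) * 2 `^ (a - 1) * (-1) ^+ k * 2 ^- k *
  g^-1 * k`!%:R^-1 / Num.sqrt pi)); first by ring.
by rewrite divff// mul1r; ring.
Qed.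

(** Dividing x^(a-1/2) by x^(a+1/2) leaves x^(-1), the source of the extra -1 in the exponents of
    the expansion. *)
Lemma besselI_integrandE (R : realType) (a x : R) : 0 < a -> 0 < x ->
  expR (- x) * (besselI (a - 2^-1) x / x `^ (a + 2^-1)) =
  (2^-1) `^ (a - 2^-1) / (Num.sqrt pi * Gamma a) * x^-1 *
    (expR (- x) * fine (poisson_integral a x)).
Proof.
move=> a0 x0.
have /cvg_lim : series (fun k : nat => (x / 2) `^ ((2 * k)%:R + (a - 2^-1)) /
    (k`!%:R * Gamma (k%:R + 1 + (a - 2^-1)))) @ \oo -->
  (x / 2) `^ (a - 2^-1) / (Num.sqrt pi * Gamma a) * fine (poisson_integral a x).
  exact: besselI_poisson.
rewrite -/(besselI (a - 2^-1) x) => ->//.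
rewrite powRM ?(ltW x0)//.
have -> : x^-1 = x `^ (a - 2^-1) / x `^ (a + 2^-1).
  rewrite -powRB ?(gt_eqF x0) ?implybT//.
  by rewrite (_ : a - 2^-1 - (a + 2^-1) = -1) ?powR_inv1 ?ltW//; field.
ring.
Qed.

Lemma besselI_remainder (R : realType) (a : R) (N : nat) : 0 < a ->
  exists2 C : R, 0 <= C & forall x : R, 0 < x ->
    `|expR (- x) * (besselI (a - 2^-1) x / x `^ (a + 2^-1)) -
      \sum_(k < N) (-1) ^+ k / (Gamma (a - k%:R) * k`!%:R) * 2 ^- k / Num.sqrt (2 * pi) *
        Gamma (a + k%:R) * x `^ (- (a + k%:R) - 1)|
    <= C * x `^ (- (a + N%:R) - 1).
Proof.
move=> a0; have [C C0 HC] := watson_remainder N a0.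
pose K := (2^-1) `^ (a - 2^-1) / (Num.sqrt pi * Gamma a).
have K0 : 0 <= K.
  rewrite divr_ge0 ?powR_ge0//; apply: mulr_ge0; first exact: sqrtr_ge0.
  exact/ltW/Gamma_gt0.
exists (K * C); first exact: mulr_ge0.
move=> x x0; rewrite besselI_integrandE// -/K.
have xp p : x `^ (p - 1) = x^-1 * x `^ p.
  by rewrite powRB ?(gt_eqF x0) ?implybT// powRr1 ?ltW// mulrC.
have -> : \sum_(k < N) (-1) ^+ k / (Gamma (a - k%:R) * k`!%:R) * 2 ^- k / Num.sqrt (2 * pi) *
        Gamma (a + k%:R) * x `^ (- (a + k%:R) - 1) =
    K * x^-1 * \sum_(k < N) 2 `^ (a - 1) * gbinomial (a - 1) k * (- 2^-1) ^+ k *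
        (x `^ (- (a + k%:R)) * Gamma (a + k%:R)).
  rewrite mulr_sumr; apply: eq_bigr => k _.
  by rewrite -besselI_coef// -/K xp; ring.
rewrite -mulrBr normrM ger0_norm; last first.
  by rewrite mulr_ge0// invr_ge0 ltW.
rewrite xp; apply: le_trans (ler_wpM2l _ (HC x x0)) _.
  by rewrite mulr_ge0// invr_ge0 ltW.
by rewrite le_eqVlt; apply/orP; left; apply/eqP; ring.
Qed.

(** * The tail integral *)

Lemma measurable_besselI_integrand (R : realType) (a : R) : 0 < a ->
  measurable_fun (`]0, +oo[%classic : set R)
    (fun x : R => expR (- x) * (besselI (a - 2^-1) x / x `^ (a + 2^-1))).
Proof.
move=> a0; apply: measurable_funM.
  by apply: measurable_funTS; apply: measurableT_comp.
apply: measurable_funM; last first.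
  rewrite (_ : (fun x => _) = (fun x : R => x `^ (- (a + 2^-1)))); last first.
    by apply/funext => x; rewrite powRN.
  by apply: measurable_funTS; exact: measurable_powR.
apply: (@measurable_fun_cvg _ _ _ _ (fun n (x : R) => series (fun k : nat =>
    (x / 2) `^ ((2 * k)%:R + (a - 2^-1)) /
    (k`!%:R * Gamma (k%:R + 1 + (a - 2^-1)))) n)).
  move=> n; apply: measurable_funTS; apply: measurable_sum => k.
  apply: measurable_funM => //.
  apply: (measurableT_comp (measurable_powR _)).
  exact: measurable_funM.
move=> x; rewrite /= in_itv/= andbT => x0.
have c := besselI_poisson a0 x0.
by rewrite /besselI (cvg_lim _ c).
Qed.

Lemma powR_tail_integrable (R : realType) (p y : R) : 0 < p -> 0 < y ->
  lebesgue_measure.-integrable `]y, +oo[%classic (EFin \o (fun x : R => x `^ (- p - 1))) /\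
  (\int[lebesgue_measure]_(x in `]y, +oo[) (x `^ (- p - 1)))%R = y `^ (- p) / p.
Proof.
move=> p0 y0; apply: ge0_integrable_EFin => //.
- by apply: measurable_funTS; exact: measurable_powR.
- by move=> x _; exact: powR_ge0.
- exact: integral_powR_tail.
Qed.

Lemma besselI_tail_remainder (R : realType) (a : R) (N : nat) : 0 < a ->
  exists2 C : R, 0 <= C & forall y : R, 0 < y ->
    `|(\int[lebesgue_measure]_(x in `]y, +oo[)
         (expR (- x) * (besselI (a - 2^-1) x / x `^ (a + 2^-1))))%R -
      \sum_(k < N) (-1) ^+ k / (Gamma (a - k%:R) * k`!%:R) * 2 ^- k / Num.sqrt (2 * pi) *
        Gamma (a + k%:R) * (y `^ (- (a + k%:R)) / (a + k%:R))|
    <= C * y `^ (- (a + N%:R)).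
Proof.
move=> a0; have [C C0 HC] := besselI_remainder N a0.
(* For N = 0 the sum is empty and the bound is C' x^(-a-1), which makes the integrand integrable on
   (y, +oo). *)
have [C' C'0 HC'] := besselI_remainder 0 a0.
have aN k : 0 < a + k%:R :> R by rewrite ltr_wpDr.
(* Integrating x^(-(a+N)-1) divides by a + N; on the terms of the sum the same step yields the
   factor 1 / (rho + k - 1/2) of the final coefficients. *)
exists (C / (a + N%:R)); first by rewrite divr_ge0// ltW.
move=> y y0; pose D : set R := `]y, +oo[%classic.
pose c k : R := (-1) ^+ k / (Gamma (a - k%:R) * k`!%:R) * 2 ^- k / Num.sqrt (2 * pi) *
        Gamma (a + k%:R).
pose g (x : R) := expR (- x) * (besselI (a - 2^-1) x / x `^ (a + 2^-1)).
pose t k (x : R) := x `^ (- (a + k%:R) - 1).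
pose ct k (x : R) := c k * t k x.
have mD : measurable (D : set (measurableTypeR R)) by exact: measurable_itv.
have Dgt0 x : D x -> 0 < x by rewrite /D/= in_itv/= andbT; exact: lt_trans.
have ti k : lebesgue_measure.-integrable D (EFin \o t k) /\
    (\int[lebesgue_measure]_(x in D) t k x)%R = y `^ (- (a + k%:R)) / (a + k%:R).
  exact: powR_tail_integrable.
have Zi (e : R) k : lebesgue_measure.-integrable D (EFin \o (fun x => e * t k x)).
  have := integrableZl mD e (ti k).1.
  by apply: eq_integrable => // s _ /=; rewrite EFinM.
have gi : lebesgue_measure.-integrable D (EFin \o g).
  apply: le_integrable (Zi C' 0%N) => //.
    apply/measurable_EFinP; apply: measurable_funS (measurable_besselI_integrand a0) => //.
    by move=> x /Dgt0; rewrite /= in_itv/= andbT.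
  move=> x /Dgt0 x0; rewrite /= lee_fin.
  have := HC' x x0; rewrite big_ord0 subr0 => /le_trans; apply.
  exact: ler_norm.
have -> : \sum_(k < N) (-1) ^+ k / (Gamma (a - k%:R) * k`!%:R) * 2 ^- k / Num.sqrt (2 * pi) *
        Gamma (a + k%:R) * (y `^ (- (a + k%:R)) / (a + k%:R)) =
    (\int[lebesgue_measure]_(x in D) \sum_(k < N) ct k x)%R.
  transitivity (\sum_(k < N) (\int[lebesgue_measure]_(x in D) ct k x)%R).
    apply: eq_bigr => k _; rewrite -(ti k).2.
    exact: (esym (RintegralZl (c k) mD (ti k).1)).
  by apply/esym/Rintegral_sum => // k; exact: Zi.
have -> : C / (a + N%:R) * y `^ (- (a + N%:R)) =
    (\int[lebesgue_measure]_(x in D) (C * t N x))%R.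
  by rewrite (RintegralZl C mD (ti N).1) (ti N).2; ring.
apply: dist_Rintegral_le => //.
  by apply: integrable_EFin_sum => // k; exact: Zi.
by move=> x /Dgt0 x0; exact: HC.
Qed.

Theorem lemma2 (R : realType) (rho : R) (hrho : 1 / 2 < rho) :
  Poincare_expansion
    (fun y : R => (\int[@lebesgue_measure R]_(x in `]y, +oo[)
                     (expR (- x) * (besselI (rho - 1) x / x `^ rho)))%R)
    (fun y : R => y `^ (- rho + 1 / 2) / Num.sqrt (2 * pi))
    (fun k : nat =>
       ((-1) ^+ k * Gamma (rho + k%:R - 1 / 2))
         / ((rho + k%:R - 1 / 2) * Gamma (rho - k%:R - 1 / 2) * k`!%:R)
         * 2 ^- k).
Proof.
have [a aE] : exists a, a = rho - 2^-1 by exists (rho - 2^-1).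
have a0 : 0 < a by lra.
have rE : rho = a + 2^-1 by lra.
rewrite rE div1r => {hrho aE rE rho}.
have -> : a + 2^-1 - 1 = a - 2^-1 by field.
have -> : - (a + 2^-1) + 2^-1 = - a by ring.
move=> N; have [C C0 HC] := besselI_tail_remainder N a0.
have sp0 : 0 < Num.sqrt (2 * pi) :> R by rewrite sqrtr_gt0 mulr_gt0// pi_gt0.
pose F (y : R) := (\int[lebesgue_measure]_(x in `]y, +oo[)
  (expR (- x) * (besselI (a - 2^-1) x / x `^ (a + 2^-1))))%R.
pose c (k : nat) := ((-1) ^+ k * Gamma (a + 2^-1 + k%:R - 2^-1)) /
  ((a + 2^-1 + k%:R - 2^-1) * Gamma (a + 2^-1 - k%:R - 2^-1) * k`!%:R) * 2 ^- k.
pose h (y : R) := y `^ (- a) / Num.sqrt (2 * pi).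
have h0 y : 0 < y -> 0 < h y by move=> y0; rewrite divr_gt0// powR_gt0.
suff : exists2 r : R -> R, (r : R -> R^o) =O_ (pinfty_nbhs R) (fun y : R => y ^- N : R^o) &
    \forall y \near +oo, F y = h y * (\sum_(k < N) c k * y ^- k + r y) by [].
(* The remainder is the solution of the required equation, which can be divided by h y once y >
   0. *)
exists (fun y => F y / h y - \sum_(k < N) c k * y ^- k); last first.
  near=> y; have y0 : 0 < y by [].
  rewrite addrC subrK mulrCA divff ?mulr1// gt_eqF//; exact: h0.
(* Dividing by h y contributes sqrt (2 pi); the 1 makes the constant strictly positive even if C =
   0. *)
apply/eqO_exP; exists (Num.sqrt (2 * pi) * C + 1).
  by rewrite ltr_wpDl// mulr_ge0// ltW.
near=> y; have y0 : 0 < y by [].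
have hy := h0 y y0.
have -> : F y / h y - \sum_(k < N) c k * y ^- k =
  (F y - \sum_(k < N) (-1) ^+ k / (Gamma (a - k%:R) * k`!%:R) * 2 ^- k / Num.sqrt (2 * pi) *
        Gamma (a + k%:R) * (y `^ (- (a + k%:R)) / (a + k%:R))) / h y.
  rewrite mulrBl mulr_suml; congr (_ - _); apply: eq_bigr => k _.
  rewrite /c (_ : a + 2^-1 + k%:R - 2^-1 = a + k%:R); last by ring.
  rewrite (_ : a + 2^-1 - k%:R - 2^-1 = a - k%:R); last by ring.
  have -> : y `^ (- (a + k%:R)) = y `^ (- a) * y ^- k.
    by rewrite opprD powRD ?(gt_eqF y0) ?implybT// powR_invn// ltW.
  have yp : y `^ (- a) != 0 by rewrite gt_eqF// powR_gt0.
  have sp : Num.sqrt (2 * pi) != 0 :> R by rewrite gt_eqF.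
  rewrite /h invf_div; move: (Gamma (a + k%:R)) (Gamma (a - k%:R)) => G g.
  rewrite !invfM; move: g^-1 (k`!%:R^-1) (2 ^- k) (y ^- k) (a + k%:R)^-1 => *.
  by field; apply/andP; split.
rewrite normrM [`|(h y)^-1|]ger0_norm ?invr_ge0 ?(ltW hy)// ler_pdivrMr//.
apply: le_trans (HC y y0) _.
have yN : 0 < y ^- N by rewrite invr_gt0 exprn_gt0.
rewrite ger0_norm ?(ltW yN)// opprD powRD ?(gt_eqF y0) ?implybT// powR_invn ?(ltW y0)//.
have -> : (Num.sqrt (2 * pi) * C + 1) * y ^- N * h y =
    C * (y `^ (- a) * y ^- N) + h y * y ^- N.
  by rewrite /h; move: (y ^- N) => m; field; rewrite gt_eqF.
by rewrite lerDl mulr_ge0// ltW.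
Unshelve. all: by end_near. Qed.
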